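(* Let $c\in\mathbb{R}$, $r\ge0$ an integer, $M_0,\dots,M_r\ge0$, and let $\mu$ be a finite positive Borel measure supported on an infinite subset of $\mathbb{R}$. Let $\{p_n^{[2j]}\}_{n\ge0}$ be the orthonormal polynomials with respect to $(x-c)^{2j}\,d\mu(x)$ and $\{q_n\}_{n\ge0}$ the orthonormal polynomials with respect to $\langle p,q\rangle=\int p(x)q(x)\,d\mu(x)+\sum_{i=0}^r M_i\,p^{(i)}(c)\,q^{(i)}(c)$. Suppose that there exists a strictly increasing function $f:\{0,1,2,\dots\}\to\mathbb{R}$ with $2f(0)+1>0$ such that for all $j=0,1,\dots,r+1$ and every integer $k\ge0$, $$(p_n^{[2j]})^{(k)}(c)\cong C_{k,j}\,(-1)^n\,n^{f(k+j)}\qquad(n\ge k,\ n\to\infty),$$ where $C_{k,j}$ is a nonzero constant independent of $n$. For all sufficiently large $n$, let $(\lambda_{j,n})_{j=0}^{r+1}$ be the coefficients in the connection formula $$q_n(x)=\sum_{j=0}^{r+1}\lambda_{j,n}\,(x-c)^j\,p_{n-j}^{[2j]}(x)$$ (these exist and are unique for $n$ large, since $p_{n-j}^{[2j]}(c)\ne0$ for $0\le j\le r+1$ and $n$ large). Then for each $j=0,1,\dots,r+1$ the limit $\lim_n\lambda_{j,n}=\lambda_j\in\mathbb{R}$ exists. Moreover, if all the masses $M_0,\dots,M_r$ are positive, then $$\lim_n\lambda_{j,n}=0\ \ (j=0,1,\dots,r)\qquad\text{and}\qquad \lim_n\lambda_{r+1,n}\neq0.$$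
   Context: All moments of $\mu$ are finite. Orthonormal polynomials are normalized with positive leading coefficients, the $n$-th one having exact degree $n$. The notation $x_n\cong y_n$ means $x_n/y_n\to1$ as $n\to\infty$; asymptotics in $n$ are for fixed $k$ and $j$. *)

(* Defs.v *)
From HB Require Import structures.
From mathcomp Require Export all_boot all_order all_algebra.
From mathcomp Require Export all_classical all_reals all_analysis.
Export Order.TTheory GRing.Theory Num.Theory.
Export numFieldNormedType.Exports.

Set Implicit Arguments.
Unset Strict Implicit.
Unset Printing Implicit Defensive.

Local Open Scope classical_set_scope.
Local Open Scope ring_scope.

Definition msupport (R : realType)
    (mu : {measure set (measurableTypeR R) -> \bar R}) : set R :=
  [set x : R | forall U : set R, open U -> U x -> (0 < mu U)%E].

Definition finite_moments (R : realType)
    (mu : {measure set (measurableTypeR R) -> \bar R}) : Prop :=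
  forall n : nat, mu.-integrable setT (fun x : R => (x ^+ n)%:E).

(* The bilinear form of the measure (x - c)^{2j} dmu(x). *)
Definition weighted_form (R : realType)
    (mu : {measure set (measurableTypeR R) -> \bar R}) (c : R) (j : nat)
    (p q : {poly R}) : R :=
  \int[mu]_(x in setT) (p.[x] * q.[x] * (x - c) ^+ (2 * j)).

Definition sobolev_form (R : realType)
    (mu : {measure set (measurableTypeR R) -> \bar R}) (c : R) (r : nat)
    (M : 'I_r.+1 -> R) (p q : {poly R}) : R :=
  \int[mu]_(x in setT) (p.[x] * q.[x])
  + \sum_(i < r.+1) M i * p^`(i).[c] * q^`(i).[c].

(* [size p = n.+1] says that [p] has exact degree [n]. *)
Definition orthonormal_polys (R : realType)
    (form : {poly R} -> {poly R} -> R) (p : nat -> {poly R}) : Prop :=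
  (forall n, size (p n) = n.+1 /\ 0 < lead_coef (p n)) /\
  (forall m n, form (p m) (p n) = (m == n)%:R).

Definition asymp_equiv (R : realType) (x y : nat -> R) : Prop :=
  x n / y n @[n --> \oo] --> (1 : R).

(* [p j n] stands for p_n^{[2j]}.  The truncated subtraction [n - j] is the
   true one as soon as [r.+1 <= n], and the formula is only used for large
   [n]. *)
Definition connection_formula (R : realType) (c : R) (r : nat)
    (p : nat -> nat -> {poly R}) (q : nat -> {poly R}) (n : nat)
    (lam : 'rV[R]_(r.+2)) : Prop :=
  q n = \sum_(j < r.+2) lam 0 j *: (('X - c%:P) ^+ j * p j (n - j)%N).

(* Main.v *)
(**
Dividing the difference of [q n] and its first [r.+1] connection terms by
[(x - c)^(r+1)] leaves a polynomial which orthogonality forces to be a multiple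
of [p r.+1 (n - r.+1)], so the connection coefficients exist, and differentiating
at [c] gives a triangular system for them.  It remains to find the limits of the
derivatives of [q n] at [c], rescaled by [y n k = C_k (-1)^n n^(f k)].  Expanding
[q n] in the basis [p 0] gives, with [a n] the ratio of the leading coefficients,

   q_n^(k)(c) = a_n p_n^(k)(c) - sum_i M_i q_n^(i)(c) K_n^(k,i)(c, c),
   1 / a_n = a_n + sum_i M_i q_n^(i)(c) p_n^(i)(c).

By the Stolz-Cesaro theorem the rescaled kernels tend to the entries
[1 / (f k + f i + 1)] of a Cauchy matrix, which is invertible since [f] is
injective.  Hence the rescaled numbers [M_i q_n^(i)(c)] converge to some [x_i],
[a_n] tends to 1, and the rescaled [q_n^(k)(c)] tends to
[1 - sum_i x_i / (f k + f i + 1)].  As a function of [f k] this is a nonzero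
rational function with at most [r.+1] zeros; when all masses are positive these
are [f 0], ..., [f r], so it does not vanish at [f r.+1].
*)
From HB Require Import structures.
From mathcomp Require Import zify ring lra.
Require Import Defs.

Set Implicit Arguments.
Unset Strict Implicit.
Unset Printing Implicit Defensive.

Local Open Scope classical_set_scope.
Local Open Scope ring_scope.

Lemma derivn_mul_XsubC_at (R : realType) (c : R) (s : {poly R}) (j k : nat) :
  ((('X - c%:P) ^+ j * s)^`(k)).[c] =
  if (j <= k)%N then (k ^_ j)%:R * (s^`(k - j)).[c] else 0.
Proof.
have step (t : {poly R}) (m : nat) :
    ((('X - c%:P) * t)^`(m.+1)) =
    ('X - c%:P) * t^`(m.+1) + t^`(m) *+ m.+1.
  elim: m => [|m IH].
    by rewrite !derivn1 derivM derivXsubC mul1r addrC derivn0.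
  rewrite derivnS IH derivD derivM derivXsubC mul1r derivMn -!derivnS.
  by rewrite [in RHS]mulrS addrCA addrA.
elim: j k => [|j IH] k.
  by rewrite expr0 mul1r leq0n ffactn0 mul1r subn0.
rewrite exprS -mulrA; case: k => [|k].
  by rewrite derivn0 ltn0 hornerM hornerXsubC subrr mul0r.
rewrite step hornerD hornerM hornerXsubC subrr mul0r add0r hornerMn IH ltnS.
case: leqP => _; last by rewrite mul0rn.
by rewrite subSS ffactSS natrM -mulrA [RHS]mulr_natl.
Qed.

Lemma scalar_sum (R : realType) (f : {poly R} -> R) (m : nat) (a : nat -> R)
    (s : nat -> {poly R}) :
  scalar f -> f (\sum_(l < m) a l *: s l) = \sum_(l < m) a l * f (s l).
Proof.
move=> flin; pose F : {scalar {poly R}} :=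
  HB.pack f (GRing.isLinear.Build _ _ _ _ f flin).
rewrite -[LHS]/(F _) linear_sum; apply: eq_bigr => l _.
by rewrite linearZ.
Qed.

Lemma orthonormal_expansion (R : realType) (B : {poly R} -> {poly R} -> R)
    (p : nat -> {poly R}) (n : nat) (s : {poly R}) :
  (forall q, scalar (B^~ q)) -> orthonormal_polys B p -> (size s <= n)%N ->
  s = \sum_(k < n) B s (p k) *: p k.
Proof.
move=> Blin [psize porth] ssize.
suff [a sE] : exists a : nat -> R, s = \sum_(k < n) a k *: p k.
  rewrite {1}sE; apply: eq_bigr => k _; congr (_ *: _).
  rewrite sE (scalar_sum _ a p (Blin _)) (bigD1 k) //= porth eqxx mulr1.
  rewrite big1 ?addr0 // => l lk.
  by rewrite porth -[_ == _ :> nat]/(l == k) (negPf lk) mulr0.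
elim: n s ssize => [|n IH] s ssize.
  exists (fun=> 0); rewrite big_ord0; apply/eqP.
  by rewrite -size_poly_eq0 -leqn0.
have [sizen leadn] := psize n.
pose b := s`_n / lead_coef (p n).
have [|a aE] := IH (s - b *: p n).
  apply/leq_sizeP => i ni; rewrite coefB coefZ.
  move: ni; rewrite leq_eqVlt => /predU1P[<-|ni].
    have -> : (p n)`_n = lead_coef (p n) by rewrite lead_coefE sizen.
    by rewrite divfK ?subrr // gt_eqF.
  by rewrite !nth_default ?sizen ?mulr0 ?subr0 // (leq_trans ssize).
exists (fun k => if k == n then b else a k).
rewrite big_ord_recr /= eqxx -{1}(subrK (b *: p n) s) aE; congr (_ + _).
by apply: eq_bigr => k _; rewrite ltn_eqF.
Qed.

Lemma orthonormal_lower (R : realType) (B : {poly R} -> {poly R} -> R)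
    (p : nat -> {poly R}) (n : nat) (s : {poly R}) :
  (forall q, scalar (B^~ q)) -> orthonormal_polys B p -> (size s <= n)%N ->
  B s (p n) = 0.
Proof.
move=> Blin hp ssize; have [_ porth] := hp.
rewrite (orthonormal_expansion Blin hp ssize).
rewrite (scalar_sum _ (fun k => B s (p k)) p (Blin _)) big1 // => k _.
by rewrite porth ltn_eqF // mulr0.
Qed.

Lemma poly_integrable (R : realType)
    (mu : {measure set (measurableTypeR R) -> \bar R}) (s : {poly R}) :
  finite_moments mu -> mu.-integrable setT (EFin \o horner s).
Proof.
move=> hmom; have -> : EFin \o horner s =
    (fun x => \sum_(i < size s) ((s`_i)%:E * (x ^+ i)%:E)%E)%E.
  apply/funext => x /=; rewrite horner_coef -sumEFin.
  by apply: eq_bigr => i _; rewrite EFinM.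
apply: integrable_sum => // i _.
by apply: integrableZl => //; exact: hmom.
Qed.

Lemma Rintegral_poly_scalar (R : realType)
    (mu : {measure set (measurableTypeR R) -> \bar R}) :
  finite_moments mu -> scalar (fun s : {poly R} => \int[mu]_x s.[x]).
Proof.
move=> hmom a s t /=.
have -> : \int[mu]_x (a *: s + t).[x] = \int[mu]_x (a * s.[x] + t.[x]).
  by apply: eq_Rintegral => x _; rewrite hornerD hornerZ.
have ints := poly_integrable s hmom; have intt := poly_integrable t hmom.
rewrite RintegralD //; first by rewrite RintegralZl.
have := poly_integrable (a *: s) hmom; congr (integrable _ _ _).
by apply/funext => x /=; rewrite hornerZ.
Qed.

Lemma weighted_formE (R : realType)
    (mu : {measure set (measurableTypeR R) -> \bar R}) (c : R) (j : nat)
    (s t : {poly R}) :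
  weighted_form mu c j s t = \int[mu]_x (s * t * ('X - c%:P) ^+ (2 * j)).[x].
Proof.
by apply: eq_Rintegral => x _; rewrite !hornerM horner_exp hornerXsubC.
Qed.

Lemma weighted_form_scalar (R : realType)
    (mu : {measure set (measurableTypeR R) -> \bar R}) (c : R) (j : nat)
    (t : {poly R}) :
  finite_moments mu -> scalar ((weighted_form mu c j)^~ t).
Proof.
move=> /Rintegral_poly_scalar Llin a s1 s2; rewrite !weighted_formE.
by rewrite !mulrDl -!scalerAl Llin.
Qed.

Lemma sobolev_formE (R : realType)
    (mu : {measure set (measurableTypeR R) -> \bar R}) (c : R) (r : nat)
    (M : 'I_r.+1 -> R) (s t : {poly R}) :
  sobolev_form mu c M s t =
  weighted_form mu c 0 s t + \sum_(i < r.+1) M i * s^`(i).[c] * t^`(i).[c].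
Proof.
congr (_ + _); apply: eq_Rintegral => x _.
by rewrite muln0 expr0 mulr1.
Qed.

Lemma sobolev_formC (R : realType)
    (mu : {measure set (measurableTypeR R) -> \bar R}) (c : R) (r : nat)
    (M : 'I_r.+1 -> R) (s t : {poly R}) :
  sobolev_form mu c M s t = sobolev_form mu c M t s.
Proof.
rewrite !sobolev_formE !weighted_formE [s * t]mulrC; congr (_ + _).
by apply: eq_bigr => i _; rewrite mulrAC.
Qed.

Lemma sobolev_form_scalar (R : realType)
    (mu : {measure set (measurableTypeR R) -> \bar R}) (c : R) (r : nat)
    (M : 'I_r.+1 -> R) (t : {poly R}) :
  finite_moments mu -> scalar ((sobolev_form mu c M)^~ t).
Proof.
move=> hmom a s1 s2; rewrite !sobolev_formE weighted_form_scalar //.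
rewrite mulrDr addrACA mulr_sumr -big_split /=; congr (_ + _).
apply: eq_bigr => i _.
by rewrite derivnD derivnZ hornerD hornerZ mulrDr mulrDl mulrCA !mulrA.
Qed.

Lemma sobolev_derivn_at (R : realType)
    (mu : {measure set (measurableTypeR R) -> \bar R}) (c : R) (r : nat)
    (M : 'I_r.+1 -> R) (p q : nat -> {poly R}) :
  finite_moments mu -> orthonormal_polys (weighted_form mu c 0) p ->
  orthonormal_polys (sobolev_form mu c M) q ->
  exists a : nat -> R, forall n,
  [/\ 0 < a n,
      (a n)^-1 = a n + \sum_(i < r.+1) M i * (q n)^`(i).[c] * (p n)^`(i).[c]
    & forall k, (q n)^`(k).[c] = a n * (p n)^`(k).[c] -
        \sum_(i < r.+1) M i * (q n)^`(i).[c] *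
          \sum_(l < n) (p l)^`(k).[c] * (p l)^`(i).[c]].
Proof.
move=> hmom hp hq.
have Wlin t := @weighted_form_scalar R mu c 0 t hmom.
have Slin t := @sobolev_form_scalar R mu c r M t hmom.
have [psize porth] := hp; have [qsize qorth] := hq.
exists (fun n => weighted_form mu c 0 (q n) (p n)) => n.
set a := weighted_form _ _ _ _ _.
have [qn qlead] := qsize n; have [pn plead] := psize n.
have Wqp l : (l < n)%N -> weighted_form mu c 0 (q n) (p l) =
    - \sum_(i < r.+1) M i * (q n)^`(i).[c] * (p l)^`(i).[c].
  move=> ln; apply/eqP; rewrite -addr_eq0 -sobolev_formE sobolev_formC.
  by rewrite (orthonormal_lower Slin hq) // (psize l).1.
have qE := orthonormal_expansion Wlin hp (eq_leq qn).
have leadE : lead_coef (q n) = a * lead_coef (p n).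
  rewrite !lead_coefE qn pn /= {1}qE big_ord_recr /= coefD coefZ coef_sum.
  rewrite big1 ?add0r // => l _; rewrite coefZ nth_default ?mulr0 //.
  by rewrite (psize l).1.
have a0 : 0 < a by rewrite -(pmulr_lgt0 a plead) -leadE.
split=> //.
  rewrite -sobolev_formE sobolev_formC.
  rewrite -[p n](subrK (a^-1 *: q n)) addrC.
  rewrite Slin qorth eqxx mulr1 (orthonormal_lower Slin hq) ?addr0 //.
  apply/leq_sizeP => i; rewrite leq_eqVlt coefB coefZ => /predU1P[<-|ni].
    have -> : (q n)`_n = lead_coef (q n) by rewrite lead_coefE qn.
    by rewrite leadE mulKf ?gt_eqF // lead_coefE pn subrr.
  by rewrite !nth_default ?qn ?pn // mulr0 subr0.
move=> k; rewrite {1}qE big_ord_recr /= -/a addrC.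
rewrite derivnD derivnZ hornerD hornerZ; congr (_ + _).
rewrite linear_sum horner_sum -sumrN /=.
under eq_bigr do rewrite derivnZ hornerZ Wqp //.
under [RHS]eq_bigr do rewrite mulr_sumr -sumrN.
rewrite exchange_big /=; apply: eq_bigr => l _.
rewrite mulNr mulr_suml -sumrN; apply: eq_bigr => i _.
by rewrite mulrA mulrAC -!mulrA; congr (- (_ * (_ * _))); rewrite mulrC.
Qed.

Lemma dvdp_connection (R : realType) (c : R) (P : nat -> {poly R})
    (s : {poly R}) (m : nat) :
  (forall j, (j < m)%N -> (P j).[c] != 0) ->
  exists a : nat -> R,
    ('X - c%:P) ^+ m %| s - \sum_(j < m) a j *: (('X - c%:P) ^+ j * P j).
Proof.
elim: m => [|m IH] Pc; first by exists (fun=> 0); rewrite dvd1p.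
have [|a /dvdpP[t tE]] := IH; first by move=> j jm; apply/Pc/ltnW.
pose b := t.[c] / (P m).[c].
exists (fun j => if j == m then b else a j).
rewrite big_ord_recr /= eqxx opprD addrA.
under eq_bigr do rewrite ltn_eqF //.
rewrite tE mulrC scalerAr -mulrBr exprSr dvdp_mul2l ?expf_neq0 ?polyXsubC_eq0 //.
by rewrite dvdp_XsubCl /root hornerD hornerN hornerZ divfK ?Pc // subrr.
Qed.

Lemma connection_exists (R : realType) (c : R) (r : nat) (M : 'I_r.+1 -> R)
    (mu : {measure set (measurableTypeR R) -> \bar R})
    (p : nat -> nat -> {poly R}) (q : nat -> {poly R}) (n : nat) :
  finite_moments mu ->
  (forall j, orthonormal_polys (weighted_form mu c j) (p j)) ->
  orthonormal_polys (sobolev_form mu c M) q ->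
  (r < n)%N -> (forall j, (j <= r)%N -> (p j (n - j)%N).[c] != 0) ->
  exists lam : 'rV[R]_r.+2, connection_formula c p q n lam.
Proof.
move=> hmom hp hq rn pc.
have Wlin t := @weighted_form_scalar R mu c r.+1 t hmom.
have Slin t := @sobolev_form_scalar R mu c r M t hmom.
have [a /dvdpP[s sE]] :=
  @dvdp_connection R c (fun j => p j (n - j)%N) (q n) r.+1 pc.
set Q := \sum_(j < _) _ in sE.
have size_Q : (size Q <= n.+1)%N.
  apply: leq_trans (size_sum _ _ _) _; apply/bigmax_leqP => /= j _.
  apply: leq_trans (size_scale_leq _ _) _.
  apply: leq_trans (size_polyMleq _ _) _.
  by rewrite size_exp_XsubC ((hp j).1 _).1 addSn addnS /= subnKC // ltnW //
     (leq_trans (ltn_ord j)).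
have size_s : (size s <= (n - r.+1).+1)%N.
  have [->|s0] := eqVneq s 0; first by rewrite size_poly0.
  have : (size (s * ('X - c%:P) ^+ r.+1)%R <= n.+1)%N.
    rewrite -sE (leq_trans (size_polyD _ _)) // size_polyN geq_max.
    by rewrite (hq.1 n).1 leqnn.
  by rewrite size_Mmonic ?monic_exp ?monicXsubC // size_exp_XsubC; lia.
have s_orth (t : {poly R}) : (size t <= n - r.+1)%N -> weighted_form mu c r.+1 s t = 0.
  move=> size_t.
  have size_Xt (m : nat) : (size (('X - c%:P) ^+ m * t)%R <= m + (n - r.+1))%N.
    apply: leq_trans (size_polyMleq _ _) _.
    by rewrite size_exp_XsubC addSn /= leq_add2l.
  have -> : weighted_form mu c r.+1 s t =
      weighted_form mu c 0 (s * ('X - c%:P) ^+ r.+1) (('X - c%:P) ^+ r.+1 * t).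
    rewrite !weighted_formE; apply: eq_Rintegral => x _; congr (_.[x]).
    by rewrite muln0 expr0 mulr1 mul2n -addnn exprD; ring.
  have XW : scalar ((weighted_form mu c 0)^~ (('X - c%:P) ^+ r.+1 * t)).
    exact: weighted_form_scalar.
  rewrite -sE -[q n - Q]addrC -scaleN1r XW /Q.
  have qn0 : weighted_form mu c 0 (q n) (('X - c%:P) ^+ r.+1 * t) = 0.
    have Xt_n : (size (('X - c%:P) ^+ r.+1 * t)%R <= n)%N.
      by rewrite (leq_trans (size_Xt _)) // subnKC.
    have := orthonormal_lower Slin hq Xt_n.
    rewrite sobolev_formC sobolev_formE big1 ?addr0 => [//|i _].
    by rewrite derivn_mul_XsubC_at leqNgt ltn_ord mulr0.
  rewrite qn0 addr0 (scalar_sum _ a (fun j => ('X - c%:P) ^+ j * p j (n - j)%N) XW).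
  rewrite big1 ?mulr0 // => j _.
  have -> : weighted_form mu c 0 (('X - c%:P) ^+ j * p j (n - j)%N)
      (('X - c%:P) ^+ r.+1 * t) =
      weighted_form mu c j (('X - c%:P) ^+ (r.+1 - j) * t) (p j (n - j)%N).
    rewrite !weighted_formE; apply: eq_Rintegral => x _; congr (_.[x]).
    have -> : ('X - c%:P) ^+ r.+1 =
        ('X - c%:P) ^+ j * ('X - c%:P) ^+ (r.+1 - j) :> {poly R}.
      by rewrite -exprD subnKC // ltnW.
    by rewrite muln0 expr0 mulr1 mul2n -addnn exprD; ring.
  rewrite (@orthonormal_lower R _ (p j)) ?mulr0 //.
    by move=> u; exact: weighted_form_scalar.
  by rewrite (leq_trans (size_Xt _)) //; have := ltn_ord j; lia.
have sE' : s = weighted_form mu c r.+1 s (p r.+1 (n - r.+1)%N) *: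
    p r.+1 (n - r.+1)%N.
  rewrite {1}(orthonormal_expansion Wlin (hp _) size_s) big_ord_recr /=.
  by rewrite big1 ?add0r // => l _; rewrite s_orth ?scale0r // ((hp _).1 _).1.
exists (\row_j if (j : nat) == r.+1
  then weighted_form mu c r.+1 s (p r.+1 (n - r.+1)%N) else a j).
rewrite /connection_formula big_ord_recr /= !mxE /= eqxx.
under eq_bigr => j _ do rewrite mxE /= ltn_eqF //.
by rewrite scalerAr -sE' -(subrK Q (q n)) addrC sE [s * _]mulrC.
Qed.

Lemma connection_unique (R : realType) (c : R) (m : nat) (P : nat -> {poly R})
    (d : nat -> R) :
  (forall j, (j < m)%N -> (P j).[c] != 0) ->
  \sum_(j < m) d j *: (('X - c%:P) ^+ j * P j) = 0 ->
  forall j, (j < m)%N -> d j = 0.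
Proof.
move=> Pc sum0; elim/ltn_ind => k IH km.
have := congr1 (fun s : {poly R} => s^`(k).[c]) sum0.
rewrite linear_sum horner_sum /= linear0 horner0.
under eq_bigr do rewrite derivnZ hornerZ derivn_mul_XsubC_at.
rewrite (bigD1 (Ordinal km)) //= leqnn subnn derivn0 big1 ?addr0.
  move/eqP; rewrite !mulf_eq0 (negPf (Pc _ km)) orbF ffactnn.
  by rewrite pnatr_eq0 -leqn0 leqNgt fact_gt0 orbF => /eqP.
move=> j jk; case: leqP => jk'; last by rewrite mulr0.
by rewrite IH ?mul0r // ltn_neqAle jk' andbT.
Qed.

Lemma cvgr_sum (R : realType) (I : Type) (s : seq I) (P : pred I)
    (u : I -> R^nat) (l : I -> R) :
  (forall i, P i -> u i n @[n --> \oo] --> l i) ->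
  \sum_(i <- s | P i) u i n @[n --> \oo] --> \sum_(i <- s | P i) l i.
Proof.
move=> ul; apply: cvg_big => //; exact: add_continuous.
Qed.

Lemma cvgr_prod (R : realType) (I : Type) (s : seq I) (P : pred I)
    (u : I -> R^nat) (l : I -> R) :
  (forall i, P i -> u i n @[n --> \oo] --> l i) ->
  \prod_(i <- s | P i) u i n @[n --> \oo] --> \prod_(i <- s | P i) l i.
Proof.
move=> ul; apply: cvg_big => //; exact: mul_continuous.
Qed.

Lemma cvgr_det (R : realType) (m : nat) (A : nat -> 'M[R]_m) (B : 'M[R]_m) :
  (forall i j, A n i j @[n --> \oo] --> B i j) ->
  \det (A n) @[n --> \oo] --> \det B.
Proof.
move=> AB; rewrite /determinant; apply: cvgr_sum => s _.
by apply: cvgMr; apply: cvgr_prod => i _; exact: AB.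
Qed.

Lemma cvgr_linear_system (R : realType) (m : nat) (A : nat -> 'M[R]_m)
    (B : 'M[R]_m) (x b : nat -> 'cV[R]_m) (bl : 'cV[R]_m) :
  (forall i j, A n i j @[n --> \oo] --> B i j) ->
  (forall i, b n i 0 @[n --> \oo] --> bl i 0) ->
  \det B != 0 ->
  (\forall n \near \oo, A n *m x n = b n) ->
  exists2 y : 'cV[R]_m, B *m y = bl &
    forall i, x n i 0 @[n --> \oo] --> y i 0.
Proof.
move=> AB bbl detB Axb.
exists ((\det B)^-1 *: (\adj B *m bl)).
  by rewrite -scalemxAr mulmxA mul_mx_adj mul_scalar_mx scalerA mulVf ?scale1r.
move=> i.
have detA := cvgr_det AB.
have adjA k : \adj (A n) i k @[n --> \oo] --> \adj B i k.
  rewrite !mxE; under eq_cvg do rewrite mxE.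
  rewrite /cofactor; apply: cvgMr; apply: cvgr_det => j1 j2.
  rewrite !mxE; under eq_cvg do rewrite !mxE.
  exact: AB.
rewrite !mxE.
have : (\det (A n))^-1 * \sum_k \adj (A n) i k * b n k 0 @[n --> \oo] -->
    (\det B)^-1 * \sum_k \adj B i k * bl k 0.
  apply: cvgM; first exact: cvgV.
  by apply: cvgr_sum => k _; apply: cvgM.
apply: cvg_trans; apply: near_eq_cvg.
near=> n.
have detAn : \det (A n) != 0.
  by near: n; apply: (cvgr_neq0 _ detA).
have /(congr1 (mulmx (\adj (A n)))) : A n *m x n = b n by near: n.
rewrite mulmxA mul_adj_mx mul_scalar_mx => /matrixP/(_ i 0).
by rewrite !mxE => <-; rewrite mulKf.
Unshelve. all: by end_near. Qed.

Lemma stolz_cesaro (R : realType) (s b : R^nat) (l : R) :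
  (forall n, b n < b n.+1) -> b n @[n --> \oo] --> +oo ->
  (s n.+1 - s n) / (b n.+1 - b n) @[n --> \oo] --> l ->
  s n / b n @[n --> \oo] --> l.
Proof.
move=> b_incr b_oo sb; apply/cvgrPdist_le => e e0.
move/cvgrPdist_le/(_ (e / 2)): sb => /(_ ltac:(by rewrite divr_gt0))[N _ sbN].
have tail k : `|(s (N + k)%N - s N) - l * (b (N + k)%N - b N)| <=
    e / 2 * (b (N + k)%N - b N).
  elim: k => [|k IH]; first by rewrite addn0 !subrr !mulr0 subr0 normr0.
  have db : 0 < b (N + k).+1 - b (N + k)%N by rewrite subr_gt0.
  have := sbN (N + k)%N (leq_addr _ _).
  rewrite -(ler_pM2r db) -[X in _ * X <= _](gtr0_norm db) -normrM mulrBl divfK ?gt_eqF //.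
  rewrite distrC addnS => step.
  apply: le_trans (_ : `|(s (N + k)%N - s N) - l * (b (N + k)%N - b N)| +
    `|s (N + k).+1 - s (N + k)%N - l * (b (N + k).+1 - b (N + k)%N)| <= _).
    apply: le_trans (ler_normD _ _); rewrite le_eqVlt; apply/orP; left; apply/eqP; congr (`|_|); ring.
  by apply: le_trans (lerD IH step) _; rewrite le_eqVlt; apply/orP; left; apply/eqP; ring.
near=> n.
have b0 : 0 < b n.
  by near: n; move/cvgryPgt : b_oo; exact.
have bC : 2 / e * (`|s N - l * b N| + e / 2 * `|b N|) <= b n.
  by near: n; move/cvgryPge : b_oo; exact.
have Nn : (N <= n)%N by near: n; exists N.
have := tail (n - N)%N; rewrite subnKC // => tl.
have -> : l - s n / b n = (l * b n - s n) / b n by rewrite mulrBl mulfK ?gt_eqF.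
rewrite normrM normfV (gtr0_norm b0) ler_pdivrMr // distrC.
have -> : s n - l * b n = ((s n - s N) - l * (b n - b N)) + (s N - l * b N).
  by ring.
apply: le_trans (ler_normD _ _) _.
have : 2 / e * (`|s N - l * b N| + e / 2 * `|b N|) * (e / 2) <= b n * (e / 2).
  by rewrite ler_pM2r // divr_gt0.
have -> : 2 / e * (`|s N - l * b N| + e / 2 * `|b N|) * (e / 2) =
  `|s N - l * b N| + e / 2 * `|b N| by field; rewrite gt_eqF.
have : - (e / 2 * b N) <= e / 2 * `|b N|.
  by rewrite -mulrN ler_pM2l ?divr_gt0 // lerNl lerNnormlW.
lra.
Unshelve. all: by end_near. Qed.

Lemma powR_cvg_at1 (R : realType) (a : R) (u : R^nat) :
  u n @[n --> \oo] --> (1 : R) -> u n `^ a @[n --> \oo] --> (1 : R).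
Proof.
move=> u1.
have cont : {for (1 : R), continuous (@powR R ^~ a)}.
  apply/differentiable_continuous/derivable1_diffP/derivable_powR.
  by rewrite in_itv /= ltr01.
by have := cvg_comp _ _ u1 cont; rewrite powR1.
Qed.

Lemma powR_diff_cvg (R : realType) (a : R) (u : R^nat) :
  (forall n, u n != 0) -> u n @[n --> \oo] --> (0 : R) ->
  ((1 + u n) `^ a - 1) / u n @[n --> \oo] --> a.
Proof.
move=> u_neq0 u0.
have [d dE] := is_derive1_powR a (ltr01 : 0 < 1 :> R).
move: d; rewrite /derivable => /cvg_ex [l dl].
have la : l = a.
  have <- := cvg_lim (@Rhausdorff R) dl.
  by rewrite -[LHS]/('D_1 (@powR R ^~ a) 1) dE powR1 mulr1.
have [+ _] := cvgr_dnbhsP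
  (fun h : R => h^-1 *: ((@powR R ^~ a \o shift 1) (h *: 1) - 1 `^ a)) 0 l.
move=> /(_ dl u (conj u_neq0 u0)); rewrite la.
apply: cvg_trans; apply: near_eq_cvg; near=> n.
by rewrite powR1 [RHS]mulrC [_%:A]mulr1 /= [u n + 1]addrC.
Unshelve. all: by end_near. Qed.

Lemma powR_natS_diff_cvg (R : realType) (a : R) :
  (n.+1%:R `^ (a + 1) - n%:R `^ (a + 1)) / n%:R `^ a @[n --> \oo] --> a + 1.
Proof.
rewrite -cvg_shiftS /=.
have := @powR_diff_cvg R (a + 1) (@harmonic R) (fun n => lt0r_neq0 (harmonic_gt0 n))
  cvg_harmonic.
apply: cvg_trans; apply: near_eq_cvg; near=> n.
rewrite /harmonic /= invrK.
have n0 : n.+1%:R != 0 :> R by rewrite pnatr_eq0.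
have -> : n.+2%:R = n.+1%:R * (1 + n.+1%:R^-1) :> R.
  by rewrite mulrDr mulr1 mulfV // natr1.
rewrite powRM // ?addr_ge0 // ?invr_ge0 //.
rewrite (powRD (x := n.+1%:R)) ?n0 ?implybT // powRr1 //.
have p0 : n.+1%:R `^ a != 0 :> R by rewrite gt_eqF // powR_gt0 ltr0Sn.
by field.
Unshelve. all: by end_near. Qed.

Lemma powR_nat_cvgy (R : realType) (a : R) :
  0 < a -> n%:R `^ a @[n --> \oo] --> +oo.
Proof.
move=> a0; apply/cvgryPge => A; near=> n.
apply: le_trans (ler_norm A) _.
rewrite -[`|A|]powRr1 // -[X in _ `^ X <= _](mulVf (lt0r_neq0 a0)) powRrM.
apply: ge0_ler_powR; rewrite ?nnegrE ?powR_ge0 ?ler0n ?(ltW a0) //.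
by near: n; exact: nbhs_infty_ger.
Unshelve. all: by end_near. Qed.

Lemma powR_sum_cvg (R : realType) (a C : R) (u : R^nat) :
  0 < a + 1 -> u n / n%:R `^ a @[n --> \oo] --> C ->
  (\sum_(l < n) u l) / n%:R `^ (a + 1) @[n --> \oo] --> C / (a + 1).
Proof.
move=> a1 uC; apply: stolz_cesaro => [n||].
- by apply: gt0_ltr_powR; rewrite ?nnegrE ?ltr_nat.
- exact: powR_nat_cvgy.
have : u n / n%:R `^ a * ((n.+1%:R `^ (a + 1) - n%:R `^ (a + 1)) /
    n%:R `^ a)^-1 @[n --> \oo] --> C / (a + 1).
  by apply: cvgM => //; apply: cvgV (lt0r_neq0 a1) _; exact: powR_natS_diff_cvg.
apply: cvg_trans; apply: near_eq_cvg; near=> n.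
have n0 : (0 < n)%N by near: n; exact: nbhs_infty_gt.
have p0 : n%:R `^ a != 0 :> R by rewrite gt_eqF // powR_gt0 // ltr0n.
by rewrite invf_div mulrA divfK // big_ord_recr /= [\sum_(_ < n) _ + _]addrC addrK.
Unshelve. all: by end_near. Qed.

Lemma partial_fraction_eq0 (R : realType) (m : nat) (P : pred 'I_m)
    (b w : 'I_m -> R) (a : R) (ts : seq R) :
  injective b -> uniq ts -> (#|P| + (a != 0)%R <= size ts)%N ->
  (forall t, t \in ts -> forall i, t + b i != 0) ->
  (forall t, t \in ts -> a + \sum_(i | P i) w i / (t + b i) = 0) ->
  a = 0 /\ forall i, P i -> w i = 0.
Proof.
move=> b_inj ts_uniq card_ts tb0 F0.
pose D (i : 'I_m) : {poly R} := 'X - (- b i)%:P.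
pose N := a *: \prod_(i | P i) D i +
  \sum_(i | P i) w i *: \prod_(l | P l && (l != i)) D l.
have prod_size (Q : pred 'I_m) : size (\prod_(i | Q i) D i) = #|Q|.+1.
  by rewrite (eq_bigl (fun i => i \in Q)) // -big_enum size_prod_XsubC -cardE.
have N_size : (size N <= #|P| + (a != 0)%R)%N.
  apply: leq_trans (size_polyD _ _) _; rewrite geq_max; apply/andP; split.
    have [->|a0] := eqVneq a 0; first by rewrite scale0r size_poly0.
    by rewrite size_scale // prod_size addn1.
  apply: leq_trans (leq_addr _ _); apply: leq_trans (size_sum _ _ _) _.
  apply/bigmax_leqP => i Pi; apply: leq_trans (size_scale_leq _ _) _.
  rewrite prod_size (cardD1 i P) [i \in P]Pi add1n ltnS subset_leq_card //.
  by apply/fintype.subsetP => l; rewrite !inE andbC.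
have N_eval t : (forall i, t + b i != 0) ->
    N.[t] = (\prod_(i | P i) (t + b i)) * (a + \sum_(i | P i) w i / (t + b i)).
  move=> tb; have prod_eval (Q : pred 'I_m) :
      (\prod_(i | Q i) D i).[t] = \prod_(i | Q i) (t + b i).
    by rewrite horner_prod; apply: eq_bigr => i _; rewrite hornerXsubC opprK.
  rewrite hornerD hornerZ prod_eval mulrDr [a * _]mulrC; congr (_ + _).
  rewrite horner_sum mulr_sumr; apply: eq_bigr => i Pi.
  by rewrite hornerZ prod_eval [in RHS](bigD1 i) //=; field; rewrite tb.
have N0 : N = 0.
  apply: contraTeq card_ts => N_neq0; rewrite -ltnNge.
  apply: leq_trans N_size; apply: max_poly_roots => //.
  by apply/allP => t tts; rewrite /root N_eval ?F0 ?mulr0 //; exact: tb0.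
have w0 i : P i -> w i = 0.
  move=> Pi; have := congr1 (horner^~ (- b i)) N0.
  rewrite horner0 hornerD hornerZ (bigD1 i) //= hornerM hornerXsubC subrr.
  rewrite mul0r mulr0 add0r horner_sum (bigD1 i) //= [X in _ + X]big1 ?addr0.
    rewrite hornerZ horner_prod => /eqP; rewrite mulf_eq0 => /orP[/eqP//|].
    rewrite prodf_seq_eq0 => /hasP[l _ /andP[/andP[_ li]]].
    by rewrite hornerXsubC opprK addrC subr_eq0 (inj_eq b_inj) (negPf li).
  move=> l /andP[Pl li]; rewrite hornerZ (bigD1 i) /=; last by rewrite Pi eq_sym.
  by rewrite hornerM hornerXsubC subrr mul0r mulr0.
split=> //; move/eqP: N0; rewrite /N [X in _ + X]big1 => [|i /w0 ->]; last by rewrite scale0r.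
by rewrite addr0 scaler_eq0 (negPf (monic_neq0 (monic_prod_XsubC _ _ _))) orbF => /eqP.
Qed.

Lemma cauchy_det_neq0 (R : realType) (m : nat) (S : pred 'I_m) (f : 'I_m -> R) :
  injective f -> (forall i j, f i + f j + 1 != 0) ->
  \det (\matrix_(k, i) if S k then (f k + f i + 1)^-1 else (k == i)%:R) != 0.
Proof.
move=> f_inj f0; set B := \matrix_(k, i) _.
rewrite -det_tr; apply/det0P => -[v v_neq0 vB].
have vBk k : \sum_i v 0 i * B k i = 0.
  have := congr1 (fun A : 'rV_m => A 0 k) vB; rewrite !mxE => {2}<-.
  by apply: eq_bigr => i _; rewrite !mxE.
have v0 k : ~~ S k -> v 0 k = 0.
  move=> Sk; rewrite -[RHS](vBk k) (bigD1 k) //= mxE (negPf Sk) eqxx mulr1.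
  rewrite big1 ?addr0 // => i ik.
  by rewrite mxE (negPf Sk) eq_sym (negPf ik) mulr0.
case/eqP: v_neq0; apply/rowP => i; rewrite [RHS]mxE.
have [Si|/v0//] := boolP (S i).
have [||||t|_ ->//] := @partial_fraction_eq0 R m S (fun i => f i + 1)
  (fun i => v 0 i) 0 [seq f k | k <- enum S].
- by move=> x y /addIr/f_inj.
- by rewrite (map_inj_uniq f_inj) enum_uniq.
- by rewrite eqxx addn0 size_map -cardE.
- by move=> t /mapP[k _ ->] l; rewrite addrA.
move=> /mapP[k]; rewrite mem_enum => Sk ->; rewrite add0r.
rewrite -[RHS](vBk k) [RHS](bigID S) /= [X in _ = _ + X]big1 ?addr0 => [|l /v0->].
  by apply: eq_bigr => l Sl; rewrite mxE (Sk : S k) addrA.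
by rewrite mul0r.
Qed.

Lemma kernel_sum_cvg (R : realType) (f : nat -> R) (P : nat -> R^nat) (C : nat -> R)
    (k i : nat) :
  let y n k := C k * (-1) ^+ n * n%:R `^ f k in
  (forall k, C k != 0) -> 0 < f k + f i + 1 ->
  (forall k, P k n / y n k @[n --> \oo] --> (1 : R)) ->
  (\sum_(l < n) P k l * P i l) / (y n k * y n i * n%:R) @[n --> \oo] -->
  (f k + f i + 1)^-1.
Proof.
move=> y C0 fki Py.
have y0 n j : (0 < n)%N -> y n j != 0.
  move=> n0; rewrite !mulf_neq0 ?expf_neq0 ?oppr_eq0 ?oner_eq0 ?C0 //.
  by rewrite gt_eqF // powR_gt0 // ltr0n.
have yy n : (0 < n)%N -> y n k * y n i = C k * C i * n%:R `^ (f k + f i).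
  move=> n0; rewrite powRD ?pnatr_eq0 -?lt0n ?n0 ?implybT // /y.
  have : (-1) ^+ n * (-1) ^+ n = 1 :> R by rewrite -exprMn mulrNN mulr1 expr1n.
  by set e := (-1) ^+ n => e1; rewrite -[RHS]mul1r -e1; ring.
have limPP : P k n * P i n / n%:R `^ (f k + f i) @[n --> \oo] --> C k * C i.
  have : C k * C i * (P k n / y n k * (P i n / y n i)) @[n --> \oo] -->
      C k * C i * (1 * 1 : R).
    by apply: cvgMr; apply: cvgM.
  rewrite !mulr1; apply: cvg_trans; apply: near_eq_cvg; near=> n.
  have n0 : (0 < n)%N by near: n; exact: nbhs_infty_gt.
  by rewrite mulf_div yy //; field; rewrite !C0 gt_eqF // powR_gt0 // ltr0n.
have CC0 : C k * C i != 0 by rewrite mulf_neq0.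
have : (C k * C i)^-1 * ((\sum_(l < n) P k l * P i l) /
    n%:R `^ (f k + f i + 1)) @[n --> \oo] -->
    (C k * C i)^-1 * (C k * C i / (f k + f i + 1)).
  by apply: cvgMr; exact: powR_sum_cvg fki limPP.
rewrite mulKf //.
apply: cvg_trans; apply: near_eq_cvg; near=> n.
have n0 : (0 < n)%N by near: n; exact: nbhs_infty_gt.
rewrite yy // powRD ?pnatr_eq0 -?lt0n ?n0 ?implybT // powRr1 ?ler0n //.
by rewrite mulrCA -invfM !mulrA.
Unshelve. all: by end_near. Qed.

Lemma sobolev_coef_cvg (R : realType) (r : nat) (M : 'I_r.+1 -> R)
    (f C a : nat -> R) (P U : nat -> R^nat) :
  let y n k := C k * (-1) ^+ n * n%:R `^ f k in
  (forall i, 0 <= M i) -> {homo f : m n / (m < n)%N >-> m < n} ->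
  0 < 2 * f 0%N + 1 -> (forall k, C k != 0) ->
  (forall k, P k n / y n k @[n --> \oo] --> (1 : R)) ->
  (forall n, 0 < a n) ->
  (forall n, (a n)^-1 = a n + \sum_(i < r.+1) M i * U i n * P i n) ->
  (forall n k, U k n = a n * P k n -
     \sum_(i < r.+1) M i * U i n * \sum_(l < n) P k l * P i l) ->
  exists x : 'I_r.+1 -> R,
    (forall k, U k n / y n k @[n --> \oo] -->
       1 - \sum_i x i / (f k + f i + 1)) /\
    (forall k, 0 < M k -> 1 - \sum_i x i / (f k + f i + 1) = 0).
Proof.
move=> y M0 f_incr f0 C0 Py a0 a_inv UE.
have f_ge k : f 0%N <= f k.
  by case: k => // k; apply/ltW/f_incr.
have f_pos k i : 0 < f k + f i + 1.
  by have := f_ge k; have := f_ge i; move: f0; lra.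
have f_inj : injective f.
  move=> i j ij; case: (ltngtP i j) => // /f_incr; by rewrite ij ltxx.
have y0 n k : (0 < n)%N -> y n k != 0.
  move=> n0; rewrite !mulf_neq0 ?expf_neq0 ?oppr_eq0 ?oner_eq0 ?C0 //.
  by rewrite gt_eqF // powR_gt0 // ltr0n.
pose G n (k i : nat) := (\sum_(l < n) P k l * P i l) / (y n k * y n i * n%:R).
have G_cvg k i : G n k i @[n --> \oo] --> (f k + f i + 1)^-1.
  exact: kernel_sum_cvg C0 (f_pos k i) Py.
pose e n (k : 'I_r.+1) := (M k * y n k ^+ 2 * n%:R)^-1.
have e_cvg k : 0 < M k -> e n k @[n --> \oo] --> (0 : R).
  move=> Mk; have fk : 0 < 2 * f k + 1 by have := f_pos k k; lra.
  have lim : (M k * C k ^+ 2)^-1 * (n%:R `^ (2 * f k + 1))^-1 @[n --> \oo] -->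
      (M k * C k ^+ 2)^-1 * 0.
    by apply: cvgMr; apply/gtr0_cvgV0; [near=> n; rewrite powR_gt0 // ltr0n; near: n; exact: nbhs_infty_gt|exact: powR_nat_cvgy].
  rewrite mulr0 in lim; apply: cvg_trans lim; apply: near_eq_cvg; near=> n.
  have n0 : (0 < n)%N by near: n; exact: nbhs_infty_gt.
  rewrite /e /y -invfM; congr (_^-1); rewrite mulrDl mul1r.
  rewrite !powRD ?pnatr_eq0 -?lt0n ?n0 ?implybT // powRr1 ?ler0n //.
  have : (-1) ^+ n * (-1) ^+ n = 1 :> R by rewrite -exprMn mulrNN mulr1 expr1n.
  by set s := (-1) ^+ n => s1; rewrite -[LHS]mul1r -s1; ring.
pose A n := \matrix_(k < r.+1, i < r.+1)
  if 0 < M k then G n k i + e n k *+ (k == i) else (k == i)%:R.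
pose B := \matrix_(k < r.+1, i < r.+1)
  if 0 < M k then (f k + f i + 1)^-1 else (k == i)%:R.
pose X n := \col_(i < r.+1) (M i * U i n * y n i * n%:R / a n).
have sum_X n k : (0 < n)%N -> \sum_i X n i 0 * G n k i =
    P k n / y n k - U k n / y n k / a n.
  move=> n0; have an0 : a n != 0 by rewrite gt_eqF.
  have n_neq0 : n%:R != 0 :> R by rewrite pnatr_eq0 -lt0n.
  rewrite UE; have -> : (a n * P k n - \sum_(i < r.+1) M i * U i n *
      \sum_(l < n) P k l * P i l) / y n k / a n = P k n / y n k -
      \sum_(i < r.+1) M i * U i n * (\sum_(l < n) P k l * P i l) / (y n k * a n).
    by rewrite -mulrA -invfM mulrBl mulr_suml; congr (_ - _); field; rewrite an0 y0.
  rewrite opprB addrC subrK; apply: eq_bigr => i _; rewrite mxE /G.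
  by field; rewrite an0 n_neq0 !y0.
have AX : \forall n \near \oo,
    A n *m X n = \col_k (if 0 < M k then P k n / y n k else 0).
  near=> n; apply/colP => k; rewrite !mxE.
  have n0 : (0 < n)%N by near: n; exact: nbhs_infty_gt.
  case: ifPn => [Mk|]; last first.
    rewrite lt_neqAle M0 andbT negbK => /eqP Mk.
    rewrite big1 // => i _; rewrite !mxE -Mk ltxx.
    by case: eqVneq => [<-|_]; rewrite ?mul0r // -Mk !mul0r mulr0.
  rewrite (eq_bigr (fun i => X n i 0 * G n k i + (e n k *+ (k == i)) * X n i 0)).
    rewrite big_split /= sum_X // (bigD1 k) //= eqxx [X in _ + (_ + X) = _]big1 => [|i ik].
      rewrite addr0 mxE /e.
      have an0 : a n != 0 by rewrite gt_eqF.
      have n_neq0 : n%:R != 0 :> R by rewrite pnatr_eq0 -lt0n.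
      by rewrite mulr1n; field; rewrite an0 n_neq0 y0 // gt_eqF.
    by rewrite eq_sym (negPf ik) mulr0n mul0r.
  by move=> i _; rewrite [A n k i]mxE Mk mulrDl [X n i 0 * _]mulrC.
have A_cvg k i : A n k i @[n --> \oo] --> B k i.
  rewrite mxE; under eq_cvg do rewrite mxE.
  case: ifPn => [Mk|_]; last exact: cvg_cst.
  rewrite -[(f k + f i + 1)^-1]addr0; apply: cvgD; first exact: G_cvg.
  case: eqVneq => _; first exact: e_cvg.
  by under eq_cvg do rewrite mulr0n; exact: cvg_cst.
have detB : \det B != 0.
  apply: (@cauchy_det_neq0 R r.+1 (fun k => 0 < M k) (fun i => f i)).
    by move=> i j /f_inj/val_inj.
  by move=> i j; rewrite gt_eqF.
have [x Bx X_cvg] : exists2 x : 'cV[R]_r.+1,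
    B *m x = \col_k (if 0 < M k then 1 else 0) &
    forall i, X n i 0 @[n --> \oo] --> x i 0.
  apply: cvgr_linear_system A_cvg _ detB AX => k; rewrite mxE.
  under eq_cvg do rewrite mxE.
  by case: ifP => _; [exact: Py|exact: cvg_cst].
have a_cvg : a n @[n --> \oo] --> (1 : R).
  have sq_cvg : (a n)^-1 ^+ 2 @[n --> \oo] --> (1 : R).
    have : 1 + \sum_i X n i 0 * (P i n / y n i) * n%:R^-1 @[n --> \oo] -->
        1 + \sum_(i < r.+1) x i 0 * 1 * 0.
      apply: cvgD; first exact: cvg_cst.
      apply: cvgr_sum => i _; apply: cvgM; first by apply: cvgM.
      apply/gtr0_cvgV0; last exact: cvgr_idn.
      by near=> n; rewrite ltr0n; near: n; exact: nbhs_infty_gt.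
    rewrite big1 ?addr0 => [|i _]; last by rewrite mulr0.
    apply: cvg_trans; apply: near_eq_cvg; near=> n.
    have n0 : (0 < n)%N by near: n; exact: nbhs_infty_gt.
    have an0 : a n != 0 by rewrite gt_eqF.
    have n_neq0 : n%:R != 0 :> R by rewrite pnatr_eq0 -lt0n.
    rewrite expr2 {1}a_inv mulrDl mulfV //; congr (_ + _).
    rewrite mulr_suml; apply: eq_bigr => i _; rewrite mxE.
    by field; rewrite an0 n_neq0 y0.
  have sqrt_cvg : Num.sqrt ((a n)^-1 ^+ 2) @[n --> \oo] --> (1 : R).
    rewrite -sqrtr1; apply: continuous_cvg sq_cvg; exact: sqrt_continuous.
  have : (Num.sqrt ((a n)^-1 ^+ 2))^-1 @[n --> \oo] --> (1^-1 : R).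
    by apply: cvgV => //; exact: oner_neq0.
  rewrite invr1; apply: cvg_trans.
  apply: near_eq_cvg; near=> n.
  by rewrite /= sqrtr_sqr ger0_norm ?invrK // invr_ge0 ltW.
exists (fun i => x i 0); split=> [k|k Mk]; last first.
  have /colP/(_ k) := Bx; rewrite !mxE Mk => Bxk.
  apply/eqP; rewrite subr_eq0 eq_sym; apply/eqP; rewrite -[RHS]Bxk.
  by apply: eq_bigr => i _; rewrite mxE Mk mulrC.
have : a n * (P k n / y n k - \sum_i X n i 0 * G n k i) @[n --> \oo] -->
    1 * (1 - \sum_i x i 0 / (f k + f i + 1)).
  apply: cvgM a_cvg _; apply: cvgB; first exact: Py.
  by apply: cvgr_sum => i _; apply: cvgM.
rewrite mul1r; apply: cvg_trans; apply: near_eq_cvg; near=> n.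
rewrite sum_X; last by near: n; exact: nbhs_infty_gt.
by rewrite opprB addrC subrK mulrC divfK // gt_eqF.
Unshelve. all: by end_near. Qed.

Lemma triangular_system_cvg (R : realType) (m : nat) (x b : nat -> R^nat)
    (A : nat -> nat -> R^nat) (bl : nat -> R) (Al : nat -> nat -> R) :
  (forall k, (k < m)%N ->
     \forall n \near \oo, b k n = \sum_(j < k.+1) x j n * A k j n) ->
  (forall k j, (k < m)%N -> (j <= k)%N -> A k j n @[n --> \oo] --> Al k j) ->
  (forall k, (k < m)%N -> Al k k != 0) ->
  (forall k, (k < m)%N -> b k n @[n --> \oo] --> bl k) ->
  exists l : nat -> R, forall k, (k < m)%N ->
    x k n @[n --> \oo] --> l k /\ bl k = \sum_(j < k.+1) l j * Al k j.
Proof.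
move=> bE AAl Al0 bbl.
have x_cvg k : (k < m)%N -> exists l : R, x k n @[n --> \oo] --> l.
  elim/ltn_ind: k => k IH km.
  have /choice[l xl] : forall j : 'I_k, exists l : R, x j n @[n --> \oo] --> l.
    by move=> j; apply: IH => //; exact: ltn_trans km.
  exists ((bl k - \sum_(j < k) l j * Al k j) / Al k k).
  have : (b k n - \sum_(j < k) x j n * A k j n) / A k k n @[n --> \oo] -->
      (bl k - \sum_(j < k) l j * Al k j) / Al k k.
    apply: cvgM; last by apply: cvgV; [exact: Al0|exact: AAl].
    apply: cvgB; first exact: bbl.
    by apply: cvgr_sum => j _; apply: cvgM => //; apply: AAl => //; exact: ltnW.
  apply: cvg_trans; apply: near_eq_cvg; near=> n.
  have -> : b k n = \sum_(j < k.+1) x j n * A k j n by near: n; exact: bE.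
  rewrite big_ord_recr /= [_ + x k n * _]addrC addrK mulfK //.
  by near: n; apply: cvgr_neq0 (Al0 _ km); exact: AAl.
exists (fun k => limn (x k)) => k km.
have lim_x j : (j < m)%N -> x j n @[n --> \oo] --> limn (x j).
  by move=> /x_cvg[l xl]; rewrite (cvg_lim _ xl).
split; first exact: lim_x.
have /(cvg_lim (@Rhausdorff R)) <- := bbl _ km.
apply: (cvg_lim (@Rhausdorff R)).
have : \sum_(j < k.+1) x j n * A k j n @[n --> \oo] -->
    \sum_(j < k.+1) limn (x j) * Al k j.
  apply: cvgr_sum => j _; have jk : (j <= k)%N by rewrite -ltnS.
  by apply: cvgM; [apply/lim_x/(leq_ltn_trans jk)|exact: AAl].
apply: cvg_trans; apply: near_eq_cvg; near=> n.
by apply/esym; near: n; exact: bE.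
Unshelve. all: by end_near. Qed.

Lemma asymp_equiv_shift (R : realType) (u : R^nat) (C D F : R) (j : nat) :
  C != 0 -> D != 0 ->
  asymp_equiv u (fun n => C * (-1) ^+ n * n%:R `^ F) ->
  u (n - j)%N / (D * (-1) ^+ n * n%:R `^ F) @[n --> \oo] -->
  C * (-1) ^+ j / D.
Proof.
move=> C0 D0 uC; rewrite -(cvg_shiftn j) /=.
have ratio : (1 + j%:R * n%:R^-1)^-1 `^ F @[n --> \oo] --> (1 : R).
  apply: powR_cvg_at1; rewrite -[X in _ --> X]invr1.
  apply: cvgV; first exact: oner_neq0.
  have : 1 + j%:R * n%:R^-1 @[n --> \oo] --> (1 + j%:R * 0 : R).
    apply: cvgD; first exact: cvg_cst.
    apply: cvgMr; apply/gtr0_cvgV0; last exact: cvgr_idn.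
    by near=> n; rewrite ltr0n; near: n; exact: nbhs_infty_gt.
  by rewrite mulr0 addr0.
have : u n / (C * (-1) ^+ n * n%:R `^ F) * (1 + j%:R * n%:R^-1)^-1 `^ F *
    (C * (-1) ^+ j / D) @[n --> \oo] --> 1 * 1 * (C * (-1) ^+ j / D).
  by apply: cvgM; [apply: cvgM|exact: cvg_cst].
rewrite !mul1r; apply: cvg_trans; apply: near_eq_cvg; near=> n.
have n0 : (0 < n)%N by near: n; exact: nbhs_infty_gt.
have nF : 0 < n%:R `^ F :> R by rewrite powR_gt0 // ltr0n.
have njF : 0 < (n + j)%:R `^ F :> R by rewrite powR_gt0 // ltr0n ltn_addr.
have -> : (1 + j%:R * n%:R^-1)^-1 `^ F = n%:R `^ F / (n + j)%:R `^ F :> R.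
  have -> : (1 + j%:R * n%:R^-1)^-1 = n%:R / (n + j)%:R :> R.
    rewrite natrD; field; rewrite -natrD !pnatr_eq0 -!lt0n n0 ltn_addr //.
  rewrite powRM ?ler0n ?invr_ge0 ?ler0n //; congr (_ * _).
  apply: (mulfI (lt0r_neq0 njF)); rewrite mulfV ?gt_eqF //.
  rewrite -powRM ?ler0n ?invr_ge0 ?ler0n // mulfV ?powR1 //.
  by rewrite pnatr_eq0 -lt0n ltn_addr.
rewrite addnK exprD.
have s1 k : (-1) ^+ k * (-1) ^+ k = 1 :> R by rewrite -exprMn mulrNN mulr1 expr1n.
have s0 k : (-1) ^+ k != 0 :> R by rewrite expf_neq0 // oppr_eq0 oner_eq0.
rewrite -[RHS]mulr1 -[X in _ = _ * X](s1 j).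
move: (s0 n) (s0 j) nF njF; set sn := (-1) ^+ n; set sj := (-1) ^+ j.
move=> sn0 sj0 /lt0r_neq0 nF /lt0r_neq0 njF.
by field; rewrite C0 D0 sn0 sj0 nF njF.
Unshelve. all: by end_near. Qed.

Lemma connection_derivn_at (R : realType) (c : R) (r n k : nat)
    (p : nat -> nat -> {poly R}) (q : nat -> {poly R}) (lam : 'rV[R]_r.+2) :
  connection_formula c p q n lam -> (k < r.+2)%N ->
  (q n)^`(k).[c] = \sum_(j < k.+1) lam 0 (inord j) *
    ((k ^_ j)%:R * (p j (n - j)%N)^`(k - j).[c]).
Proof.
move=> -> kr; rewrite linear_sum horner_sum /=.
rewrite (big_ord_widen r.+2 (fun j => lam 0 (inord j) *
  ((k ^_ j)%:R * (p j (n - j)%N)^`(k - j).[c])) kr) [RHS]big_mkcond /=.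
apply: eq_bigr => j _; rewrite derivnZ hornerZ derivn_mul_XsubC_at ltnS inord_val.
by case: ifP => // _; rewrite mulr0.
Qed.

Theorem theorem2 (R : realType) (c : R) (r : nat) (M : 'I_r.+1 -> R)
    (mu : {finite_measure set (measurableTypeR R) -> \bar R})
    (p : nat -> nat -> {poly R}) (q : nat -> {poly R})
    (hM : forall i, 0 <= M i)
    (hmom : finite_moments mu)
    (hsupp : infinite_set (msupport mu))
    (hp : forall j : nat, orthonormal_polys (weighted_form mu c j) (p j))
    (hq : orthonormal_polys (sobolev_form mu c M) q)
    (hasymp : exists f : nat -> R,
      [/\ {homo f : m n / (m < n)%N >-> m < n},
          0 < 2 * f 0%N + 1
        & forall j k : nat, (j <= r.+1)%N ->
          exists2 C : R, C != 0 &
            asymp_equiv (fun n => (p j n)^`(k).[c])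
                        (fun n => C * (-1) ^+ n * n%:R `^ f (k + j)%N)]) :
  (\forall n \near \oo,
     exists! lam : 'rV[R]_(r.+2), connection_formula c p q n lam) /\
  (forall lambda : nat -> 'rV[R]_(r.+2),
     (\forall n \near \oo, connection_formula c p q n (lambda n)) ->
     (forall j : 'I_r.+2,
        exists l : R, lambda n 0 j @[n --> \oo] --> l) /\
     ((forall i, 0 < M i) ->
        (forall j : 'I_r.+2, (j <= r)%N ->
           lambda n 0 j @[n --> \oo] --> (0 : R)) /\
        (exists2 l : R, l != 0 & lambda n 0 ord_max @[n --> \oo] --> l))).
Proof.
have [f [f_incr f0 asymp]] := hasymp.
have /choice[C CP] : forall jk : nat * nat, exists C : R, (jk.1 <= r.+1)%N ->
    C != 0 /\ asymp_equiv (fun n => (p jk.1 n)^`(jk.2).[c])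
      (fun n => C * (-1) ^+ n * n%:R `^ f (jk.2 + jk.1)%N).
  move=> [j k] /=; have [jr|_] := leqP j r.+1; last by exists 0.
  by have [C C0 CE] := asymp j k jr; exists C.
have C0 j k : (j <= r.+1)%N -> C (j, k) != 0 by move=> /(CP (j, k))[].
pose y n k := C (0%N, k) * (-1) ^+ n * n%:R `^ f k.
have shift_cvg k j : (j <= k)%N -> (j <= r.+1)%N ->
    (p j (n - j)%N)^`(k - j).[c] / y n k @[n --> \oo] -->
    C (j, k - j)%N * (-1) ^+ j / C (0%N, k).
  move=> jk jr; apply: (asymp_equiv_shift (u := fun n => (p j n)^`(k - j).[c])).
  - exact: C0.
  - exact: C0.
  by have [_] := CP (j, k - j)%N jr; rewrite /= subnK.
have p_neq0 : \forall n \near \oo, forall j : 'I_r.+2, (p j (n - j)%N).[c] != 0.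
  apply: filter_forall => j; have jr : (j <= r.+1)%N by rewrite -ltnS.
  have lim := shift_cvg j j (leqnn j) jr; rewrite subnn in lim.
  have lim0 : C (j : nat, 0%N) * (-1) ^+ j / C (0%N, j : nat) != 0.
    by rewrite !mulf_neq0 ?invr_eq0 ?C0 // expf_neq0 // oppr_eq0 oner_eq0.
  apply: filterS (cvgr_neq0 _ lim lim0) => n.
  by rewrite mulf_eq0 negb_or derivn0 => /andP[].
have P_cvg k : (p 0%N n)^`(k).[c] / y n k @[n --> \oo] --> (1 : R).
  by have [_] := CP (0%N, k) isT; rewrite addn0.
have [a aP] := sobolev_derivn_at hmom (hp 0%N) hq.
have [x [U_cvg v0]] := @sobolev_coef_cvg R r M f (fun k => C (0%N, k)) a
  (fun k n => (p 0%N n)^`(k).[c]) (fun k n => (q n)^`(k).[c]) hM f_incr f0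
  (fun k => C0 0%N k isT) P_cvg
  (fun n => let: And3 h _ _ := aP n in h)
  (fun n => let: And3 _ h _ := aP n in h)
  (fun n => let: And3 _ _ h := aP n in h).
split.
  near=> n.
  have pn : forall j : 'I_r.+2, (p j (n - j)%N).[c] != 0 by near: n.
  have pn' j : (j < r.+2)%N -> (p j (n - j)%N).[c] != 0.
    by move=> jr; exact: (pn (Ordinal jr)).
  have rn : (r < n)%N by near: n; exact: nbhs_infty_gt.
  have [lam lamP] := connection_exists hmom hp hq rn
    (fun j (jr : (j <= r)%N) => pn' j (leqW jr)).
  exists lam; split=> // lam' lamP'.
  have sum0 : \sum_(j < r.+2) (lam 0 (inord j) - lam' 0 (inord j)) *:
      (('X - c%:P) ^+ j * p j (n - j)%N) = 0.
    under eq_bigr do rewrite scalerBl inord_val.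
    by rewrite sumrB -lamP -lamP' subrr.
  have d0 := connection_unique (P := fun j => p j (n - j)%N)
    (d := fun j => lam 0 (inord j) - lam' 0 (inord j)) pn' sum0.
  apply/rowP => j; apply/eqP; rewrite -subr_eq0.
  by have := d0 j (ltn_ord j); rewrite inord_val => ->.
move=> lambda lambdaP.
have Al_neq0 k : (k < r.+2)%N ->
    (k ^_ k)%:R * (C (k, k - k)%N * (-1) ^+ k / C (0%N, k)) != 0.
  move=> kr; apply: mulf_neq0; first by rewrite ffactnn pnatr_eq0 -lt0n fact_gt0.
  by rewrite !mulf_neq0 ?invr_eq0 ?C0 // expf_neq0 // oppr_eq0 oner_eq0.
have U_E k : (k < r.+2)%N -> \forall n \near \oo, (q n)^`(k).[c] / y n k =
    \sum_(j < k.+1) lambda n 0 (inord j) *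
      ((k ^_ j)%:R * ((p j (n - j)%N)^`(k - j).[c] / y n k)).
  move=> kr; apply: filterS lambdaP => n /connection_derivn_at -> //.
  by rewrite mulr_suml; apply: eq_bigr => j _; rewrite !mulrA.
have A_cvg k j : (k < r.+2)%N -> (j <= k)%N ->
    (k ^_ j)%:R * ((p j (n - j)%N)^`(k - j).[c] / y n k) @[n --> \oo] -->
    (k ^_ j)%:R * (C (j, k - j)%N * (-1) ^+ j / C (0%N, k)).
  move=> kr jk; apply: cvgMr; apply: shift_cvg => //.
  by rewrite (leq_trans jk).
have [l lP] := @triangular_system_cvg R r.+2 (fun j n => lambda n 0 (inord j))
  (fun k n => (q n)^`(k).[c] / y n k)
  (fun k j n => (k ^_ j)%:R * ((p j (n - j)%N)^`(k - j).[c] / y n k))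
  (fun k => 1 - \sum_i x i / (f k + f i + 1))
  (fun k j => (k ^_ j)%:R * (C (j, k - j)%N * (-1) ^+ j / C (0%N, k)))
  U_E A_cvg Al_neq0 (fun k _ => U_cvg k).
have lambda_cvg (j : 'I_r.+2) : lambda n 0 j @[n --> \oo] --> l j.
  by have [+ _] := lP j (ltn_ord j); rewrite inord_val.
split=> [j|M_gt0]; first by exists (l j).
have l0 k : (k <= r)%N -> l k = 0.
  elim/ltn_ind: k => k IH kr; have kr2 : (k < r.+2)%N by rewrite ltnS leqW.
  have [_] := lP k kr2; rewrite (v0 (Ordinal (kr : (k < r.+1)%N)) (M_gt0 _)).
  rewrite big_ord_recr /= big1 => [|j _]; last first.
    by rewrite IH ?mul0r // (leq_trans (ltnW (ltn_ord j))).
  by rewrite add0r => /esym/eqP; rewrite mulf_eq0 (negPf (Al_neq0 k kr2)) orbF => /eqP.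
split=> [j jr|]; first by rewrite -(l0 j jr); exact: lambda_cvg.
exists (l r.+1); last exact: lambda_cvg.
apply/eqP => lr0; have [_] := lP r.+1 (ltnSn _).
rewrite [RHS]big1 => [vr|j _]; last first.
  have [jr|jr] := eqVneq (j : nat) r.+1; first by rewrite jr lr0 mul0r.
  by rewrite l0 ?mul0r // -ltnS ltn_neqAle jr -ltnS ltn_ord.
have f_inj : injective f.
  by move=> i j ij; case: (ltngtP i j) => // /f_incr; rewrite ij ltxx.
have f_pos k i : 0 < f k + f i + 1.
  have f_ge m : f 0%N <= f m by case: m => // m; apply/ltW/f_incr.
  by have := f_ge k; have := f_ge i; move: f0; lra.
have [||||t|/eqP] := @partial_fraction_eq0 R r.+1 predT (fun i => f i + 1)
  (fun i => - x i) 1 [seq f k | k <- iota 0 r.+2].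
- by move=> i j /addIr/f_inj/val_inj.
- by rewrite (map_inj_uniq f_inj) iota_uniq.
- by rewrite oner_eq0 addn1 size_map size_iota card_ord.
- by move=> t /mapP[k _ ->] i; rewrite addrA gt_eqF.
- move=> /mapP[k]; rewrite mem_iota leq0n add0n ltnS /= leq_eqVlt => kr ->.
  under eq_bigr do rewrite mulNr addrA.
  rewrite sumrN; case/predU1P: kr => [->//|kr].
  exact: (v0 (Ordinal kr) (M_gt0 _)).
by rewrite oner_eq0.
Unshelve. all: by end_near. Qed.
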